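(* Let $N\geq 1$, let $A=(a_{ij})\in M_N(\mathbb{C})$ and let $0<\epsilon<1$. For $1\leq j\leq N$ let $d_j=a_{jj}$ and $r_j=\sum_{1\leq i\leq N,\ i\neq j}|a_{ij}|$. Then $$\sigma_\epsilon(A)\subseteq \bigcup_{j=1}^N D\left(d_j,\ r_j+\sqrt{N}\,\frac{2\epsilon}{1-\epsilon}\|A\|\right).$$
   Context: $M_N(\mathbb{C})$ is the algebra of complex $N\times N$ matrices; $\|\cdot\|$ is the Euclidean norm on $\mathbb{C}^N$ and the induced operator norm (spectral norm) on $M_N(\mathbb{C})$. For a scalar $z$, $z-A$ means $zI-A$. For $0<\epsilon<1$ the $\epsilon$-condition spectrum of $A$ is $$\sigma_\epsilon(A)=\{z\in\mathbb{C}: z-A \text{ is not invertible, or } \|(z-A)^{-1}\|\,\|z-A\|\geq 1/\epsilon\}.$$ $D(a,r)=\{z\in\mathbb{C}:|z-a|\leq r\}$ is the closed disc with center $a$ and radius $r$. *)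

(* Defs.v *)
From HB Require Import structures.
From mathcomp Require Import all_boot all_order all_algebra.
From mathcomp Require Import complex.
From mathcomp Require Import classical_sets reals.

Set Implicit Arguments.
Unset Strict Implicit.
Unset Printing Implicit Defensive.

Import Order.TTheory GRing.Theory Num.Theory Normc.

Local Open Scope classical_set_scope.
Local Open Scope ring_scope.

(* The modulus is the library's R-valued [normc]: the norm `|z| of z : R[i] is
   itself an element of R[i]. *)
Definition l2norm (R : realType) (n : nat) (x : 'cV[R[i]]_n) : R :=
  Num.sqrt (\sum_(i < n) normc (x i 0) ^+ 2).

(* The set is nonempty and bounded above, so [sup] is a genuine supremum. *)
Definition opnorm (R : realType) (n : nat) (A : 'M[R[i]]_n) : R :=
  sup [set l2norm (A *m x) | x in [set x : 'cV[R[i]]_n | l2norm x <= 1]].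

Definition cond_spectrum (R : realType) (n : nat) (eps : R)
    (A : 'M[R[i]]_n) : set R[i] :=
  [set z | (z%:M - A \notin unitmx) \/
           eps^-1 <= opnorm (invmx (z%:M - A)) * opnorm (z%:M - A)].

(* Not the library's [closed_ball]: it is the closure of the open ball, hence
   empty for r = 0, whereas D(a, 0) = {a}. *)
Definition cdisc (R : realType) (a : R[i]) (r : R) : set R[i] :=
  [set z | normc (z - a) <= r].

(* Main.v *)
Require Import Defs.
From HB Require Import structures.
From mathcomp Require Import all_boot all_order all_algebra.
From mathcomp Require Import complex.
From mathcomp Require Import classical_sets reals.
From mathcomp Require Import ring lra.

Import Order.TTheory GRing.Theory Num.Theory Normc.

Local Open Scope classical_set_scope.
Local Open Scope ring_scope.

(* Column diagonal dominance is a lower bound for the l1 norm: summing the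
   reverse triangle inequality over the rows of [B = z - A] gives
   [m * |x|_1 <= |B x|_1] with [m = min_j (|B_jj| - r_j)].  If [0 < m], then [B]
   is invertible, and comparing the l1 and l2 norms yields
   [m * |B^-1| <= sqrt N].  The condition number hypothesis turns this into
   [m <= eps * sqrt N * |B|].  Finally [|z| - |A| <= 1 / |B^-1| <= eps * |B|]
   and [|B| <= |z| + |A|] give [|B| <= 2 / (1 - eps) * |A|]. *)

(** * Real inequalities: Cauchy-Schwarz and the final scalar estimates *)

Lemma cauchy_schwarz_sum (R : realDomainType) (I : finType) (a b : I -> R) :
  (\sum_i a i * b i) ^+ 2 <= (\sum_i a i ^+ 2) * (\sum_i b i ^+ 2).
Proof.
(* Lagrange's identity; the factor 2 appears because the sum runs over ordered pairs. Swapping one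
   copy of the product makes it hold term by term. *)
have lagrange : \sum_i \sum_j (a i * b j - a j * b i) ^+ 2 =
    2 * ((\sum_i a i ^+ 2) * (\sum_i b i ^+ 2) - (\sum_i a i * b i) ^+ 2).
  rewrite [RHS]mulrBr mulr_natl mulr2n {2}[_ * (\sum_i b i ^+ 2)]mulrC expr2.
  rewrite !big_distrlr mulr_sumr -big_split -sumrB; apply: eq_bigr => i _ /=.
  rewrite mulr_sumr -big_split -sumrB; apply: eq_bigr => j _ /=.
  by ring.
have : 0 <= \sum_i \sum_j (a i * b j - a j * b i) ^+ 2.
  by apply: sumr_ge0 => i _; apply: sumr_ge0 => j _; apply: sqr_ge0.
by rewrite lagrange pmulr_rge0 ?ltr0n// subr_ge0.
Qed.

(** Here [a], [z], [b], [c] stand for |A|, |z|, |B^-1|, |B|. Multiplying [z - a] by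
    [1 <= eps * (b * c)] gives [z - a <= eps * c], hence [c <= eps * c + 2 * a]. *)
Lemma condition_bound (F : realFieldType) (eps a b z c : F) :
  0 < eps -> eps < 1 -> 0 <= a -> 0 <= c -> c <= z + a ->
  (z - a) * b <= 1 -> eps^-1 <= b * c -> c <= 2 / (1 - eps) * a.
Proof.
move=> e0 e1 a0 c0 cza zab cond.
have ebc : 1 <= eps * (b * c) by rewrite mulrC -ler_pdivrMr// div1r.
have za : z - a <= eps * c.
  have [le0|gt0] := leP (z - a) 0.
    by apply: le_trans le0 _; rewrite mulr_ge0// ltW.
  have := ler_wpM2l (ltW gt0) ebc; rewrite mulr1 => /le_trans; apply.
  have -> : (z - a) * (eps * (b * c)) = (z - a) * b * (eps * c) by ring.
  by apply: ler_piMl => //; rewrite mulr_ge0// ltW.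
rewrite mulrAC ler_pdivlMr ?subr_gt0//.
by lra.
Qed.

(** Used with [g] the dominance constant and [s] the square root of N:
    [g <= eps * g * b * c <= eps * s * c]. *)
Lemma gap_bound (F : realFieldType) (eps a b c g s : F) :
  0 < eps -> 0 <= g -> 0 <= c -> 0 <= s -> eps^-1 <= b * c -> g * b <= s ->
  c <= 2 / (1 - eps) * a -> g <= s * (2 * eps / (1 - eps)) * a.
Proof.
move=> e0 g0 c0 s0 cond gb ca.
have gsc : g <= eps * (s * c).
  rewrite mulrC -ler_pdivrMr//; apply: le_trans (ler_wpM2l g0 cond) _.
  by rewrite mulrA ler_wpM2r.
apply: le_trans gsc _.
have -> : s * (2 * eps / (1 - eps)) * a = eps * (s * (2 / (1 - eps) * a)).
  by rewrite [2 * eps]mulrC !mulrA [s * eps]mulrC.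
by rewrite ler_pM2l// ler_wpM2l.
Qed.

Section ModulusAndNorms.
Context {R : realType} {n : nat}.
Implicit Types (z : R[i]) (x y : 'cV[R[i]]_n) (A B : 'M[R[i]]_n).

(** * Modulus, l1 norm and l2 norm *)

Lemma normc_ge0 z : 0 <= normc z.
Proof. by case: z => a b; apply: sqrtr_ge0. Qed.

Lemma normc_sum_le (I : finType) (P : pred I) (F : I -> R[i]) :
  normc (\sum_(i | P i) F i) <= \sum_(i | P i) normc (F i).
Proof.
apply: (big_rec2 (fun u v => normc u <= v)); first by rewrite normc0.
by move=> i v u _ le_uv; apply: le_trans (le_normcD _ _) _; rewrite lerD2l.
Qed.

Definition l1norm x : R := \sum_i normc (x i 0).

Lemma l1norm_ge0 x : 0 <= l1norm x.
Proof. by apply: sumr_ge0 => i _; apply: normc_ge0. Qed.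

Lemma l1norm_eq0 x : l1norm x = 0 -> x = 0.
Proof.
move=> /psumr_eq0P x0; apply/matrixP => i j; rewrite ord1 mxE.
by apply: eq0_normc; apply: x0 => // k _; apply: normc_ge0.
Qed.

Lemma sum_sqr_normc_ge0 x : 0 <= \sum_i normc (x i 0) ^+ 2.
Proof. by apply: sumr_ge0 => i _; apply: sqr_ge0. Qed.

Lemma l2norm_ge0 x : 0 <= l2norm x.
Proof. exact: sqrtr_ge0. Qed.

Lemma l2norm_sqr x : l2norm x ^+ 2 = \sum_i normc (x i 0) ^+ 2.
Proof. by rewrite sqr_sqrtr// sum_sqr_normc_ge0. Qed.

Lemma l2norm0 : l2norm (0 : 'cV[R[i]]_n) = 0.
Proof.
rewrite /l2norm big1 ?sqrtr0// => i _.
by rewrite mxE normc0 expr0n.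
Qed.

Lemma l2normZ z x : l2norm (z *: x) = normc z * l2norm x.
Proof.
rewrite /l2norm -[X in X * _](ger0_norm (normc_ge0 z)) -sqrtr_sqr.
rewrite -sqrtrM ?sqr_ge0// mulr_sumr; congr Num.sqrt.
by apply: eq_bigr => i _; rewrite mxE normcM exprMn.
Qed.

Lemma l2normD x y : l2norm (x + y) <= l2norm x + l2norm y.
Proof.
rewrite -(@ler_pXn2r _ 2)// ?nnegrE ?addr_ge0 ?l2norm_ge0//.
have xy : \sum_i normc (x i 0) * normc (y i 0) <= l2norm x * l2norm y.
  rewrite -(@ler_pXn2r _ 2)// ?nnegrE ?mulr_ge0 ?l2norm_ge0//; last first.
    by apply: sumr_ge0 => i _; rewrite mulr_ge0 ?normc_ge0.
  by rewrite exprMn !l2norm_sqr cauchy_schwarz_sum.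
rewrite sqrrD !l2norm_sqr.
apply: (@le_trans _ _ (\sum_i (normc (x i 0) + normc (y i 0)) ^+ 2)).
  apply: ler_sum => i _; rewrite mxE ler_pXn2r ?nnegrE ?addr_ge0 ?normc_ge0//.
  exact: le_normcD.
under eq_bigr do rewrite sqrrD.
by rewrite !big_split/= lerD2r lerD2l mulr2n lerD.
Qed.

Lemma l2norm_le_l1norm x : l2norm x <= l1norm x.
Proof.
rewrite -(@ler_pXn2r _ 2)// ?nnegrE ?l2norm_ge0 ?l1norm_ge0//.
rewrite l2norm_sqr expr2 mulr_suml; apply: ler_sum => i _.
rewrite expr2 ler_wpM2l ?normc_ge0// /l1norm (bigD1 i)//= lerDl.
by apply: sumr_ge0 => j _; apply: normc_ge0.
Qed.

(** Cauchy-Schwarz against the constant vector 1; the only source of the factor sqrt N. *)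
Lemma l1norm_le_l2norm x : l1norm x <= Num.sqrt n%:R * l2norm x.
Proof.
rewrite -(@ler_pXn2r _ 2)// ?nnegrE ?mulr_ge0 ?sqrtr_ge0 ?l1norm_ge0//.
rewrite exprMn l2norm_sqr sqr_sqrtr ?ler0n//.
have := @cauchy_schwarz_sum R 'I_n (fun=> 1) (fun i => normc (x i 0)).
under eq_bigr do rewrite mul1r.
under [X in _ <= X * _ -> _]eq_bigr do rewrite expr1n.
by rewrite sumr_const card_ord.
Qed.

Lemma normc_entry_le_l2norm x i : normc (x i 0) <= l2norm x.
Proof.
rewrite -(@ler_pXn2r _ 2)// ?nnegrE ?l2norm_ge0 ?normc_ge0//.
rewrite l2norm_sqr (bigD1 i)//= lerDl.
by apply: sumr_ge0 => j _; apply: sqr_ge0.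
Qed.

(** A crude constant suffices: it makes the supremum in [opnorm] finite and handles vectors of norm
    zero. *)
Lemma l2norm_mulmx_le A x :
  l2norm (A *m x) <= (\sum_i \sum_j normc (A i j)) * l2norm x.
Proof.
apply: le_trans (l2norm_le_l1norm _) _.
rewrite mulr_suml; apply: ler_sum => i _.
rewrite mxE mulr_suml; apply: le_trans (normc_sum_le _ _ _) _.
apply: ler_sum => j _; rewrite normcM ler_wpM2l ?normc_ge0//.
exact: normc_entry_le_l2norm.
Qed.

(** * Operator norm and the resolvent bound *)

Lemma opnorm_has_ubound A :
  has_ubound [set l2norm (A *m x) | x in [set x : 'cV[R[i]]_n | l2norm x <= 1]].
Proof.
exists (\sum_i \sum_j normc (A i j)) => _ [x /= x1 <-].
apply: le_trans (l2norm_mulmx_le _ _) _; apply: ler_piMr => //.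
by apply: sumr_ge0 => i _; apply: sumr_ge0 => j _; apply: normc_ge0.
Qed.

Lemma opnorm_ge0 A : 0 <= opnorm A.
Proof.
apply: ub_le_sup; first exact: opnorm_has_ubound.
by exists 0; rewrite /= ?mulmx0 l2norm0 ?ler01.
Qed.

Lemma opnorm_le A c : 0 <= c -> (forall x, l2norm (A *m x) <= c * l2norm x) ->
  opnorm A <= c.
Proof.
move=> c0 Ac; apply: ge_sup.
  by exists (l2norm (A *m 0)); exists 0; rewrite //= l2norm0 ler01.
by move=> _ [x /= x1 <-]; apply: le_trans (Ac x) _; apply: ler_piMr.
Qed.

Lemma l2norm_mulmx A x : l2norm (A *m x) <= opnorm A * l2norm x.
Proof.
have [x0|x0] := eqVneq (l2norm x) 0.
  by have := l2norm_mulmx_le A x; rewrite x0 !mulr0.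
have {}x0 : 0 < l2norm x by rewrite lt_neqAle eq_sym x0 l2norm_ge0.
have nV : normc ((l2norm x)^-1)%:C%C = (l2norm x)^-1.
  by rewrite /= expr0n addr0 sqrtr_sqr ger0_norm// invr_ge0 l2norm_ge0.
rewrite -ler_pdivrMr// mulrC.
apply: ub_le_sup; first exact: opnorm_has_ubound.
(* The normalised vector attains the quotient |Ax| / |x| in the supremum. *)
exists (((l2norm x)^-1)%:C%C *: x) => /=.
  by rewrite l2normZ nV mulVf ?gt_eqF.
by rewrite -scalemxAr l2normZ nV.
Qed.

Lemma opnorm_scalar_sub_le z A : opnorm (z%:M - A) <= normc z + opnorm A.
Proof.
apply: opnorm_le => [|x]; first by rewrite addr_ge0 ?normc_ge0 ?opnorm_ge0.
rewrite mulmxBl mul_scalar_mx -scaleN1r mulrDl.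
apply: le_trans (l2normD _ _) _.
by rewrite !l2normZ normcN normc1 mul1r lerD2l l2norm_mulmx.
Qed.

(** With [y] the image of [x] under the inverse, x = zy - Ay, so |x| is at least (|z| - |A|)|y|. *)
Lemma opnorm_resolvent_le z A : z%:M - A \in unitmx ->
  (normc z - opnorm A) * opnorm (invmx (z%:M - A)) <= 1.
Proof.
move=> BU; have [le0|gt0] := leP (normc z - opnorm A) 0.
  by apply: le_trans ler01; rewrite mulr_le0_ge0 ?opnorm_ge0.
rewrite mulrC -ler_pdivlMr// div1r.
apply: opnorm_le => [|x]; first by rewrite invr_ge0 ltW.
rewrite mulrC ler_pdivlMr// mulrC; set y := _ *m x.
have -> : x = (z%:M - A) *m y by rewrite mulKVmx.
have -> : (z%:M - A) *m y = z *: y - A *m y by rewrite mulmxBl mul_scalar_mx.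
have := l2normD (z *: y - A *m y) (A *m y).
rewrite subrK l2normZ mulrBl => h.
by rewrite lerBlDr; apply: le_trans h _; rewrite lerD2l l2norm_mulmx.
Qed.

Lemma opnorm_le_of_condition z A (eps : R) : 0 < eps -> eps < 1 ->
  z%:M - A \in unitmx ->
  eps^-1 <= opnorm (invmx (z%:M - A)) * opnorm (z%:M - A) ->
  opnorm (z%:M - A) <= 2 / (1 - eps) * opnorm A.
Proof.
move=> e0 e1 BU cond.
exact: (condition_bound R eps _ _ _ _ e0 e1 (opnorm_ge0 A) (opnorm_ge0 _)
  (opnorm_scalar_sub_le z A) (opnorm_resolvent_le z A BU) cond).
Qed.

(** * Column diagonal dominance *)

Lemma l1norm_mulmx_ge B x :
  \sum_j (normc (B j j) - \sum_(i | i != j) normc (B i j)) * normc (x j 0)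
    <= l1norm (B *m x).
Proof.
under eq_bigr do rewrite mulrBl mulr_suml.
(* Exchanging the sums regroups the off-diagonal terms by rows, leaving one inequality per entry of
   [B *m x]. *)
rewrite sumrB lerBlDr (exchange_big_dep xpredT)//= -big_split/=.
apply: ler_sum => i _; rewrite mxE (bigD1 i)//=.
set s := \sum_(j | j != i) _.
(* The diagonal term is the full row sum minus [s]. *)
rewrite -normcM -[X in normc X](addrK s).
apply: le_trans (le_normcD _ _) _; rewrite lerD2l normcN.
apply: le_trans (normc_sum_le _ _ _) _.
rewrite (eq_bigl (fun j => i != j)); last by move=> j; rewrite eq_sym.
by apply: ler_sum => j _; rewrite normcM.
Qed.

Lemma l1norm_mulmx_ge_dominant B (m : R) x :
  (forall j, m <= normc (B j j) - \sum_(i | i != j) normc (B i j)) ->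
  m * l1norm x <= l1norm (B *m x).
Proof.
move=> Bm; apply: le_trans (l1norm_mulmx_ge _ _).
by rewrite mulr_sumr; apply: ler_sum => j _; rewrite ler_wpM2r ?normc_ge0.
Qed.

Lemma dominant_unitmx B (m : R) : 0 < m ->
  (forall j, m <= normc (B j j) - \sum_(i | i != j) normc (B i j)) ->
  B \in unitmx.
Proof.
(* [det0P] yields a row vector in the left kernel, so it is applied to the transpose of [B].
   Dominance then forces the l1 norm of the kernel vector to vanish. *)
move=> m0 Bm; rewrite -unitmx_tr unitmxE unitfE; apply/det0P => -[v v0 vB].
case/negP: v0; rewrite -trmx_eq0; apply/eqP/l1norm_eq0/le_anti.
rewrite l1norm_ge0 andbT -(pmulr_rle0 _ m0).
apply: le_trans (l1norm_mulmx_ge_dominant _ _ _ Bm) _.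
rewrite -[B]trmxK -trmx_mul vB trmx0 /l1norm big1// => i _.
by rewrite mxE normc0.
Qed.

(** For y = B^-1 x: m|y|_2 <= m|y|_1 <= |x|_1 <= sqrt N |x|_2. *)
Lemma dominant_opnorm_invmx_le B (m : R) : 0 < m ->
  (forall j, m <= normc (B j j) - \sum_(i | i != j) normc (B i j)) ->
  m * opnorm (invmx B) <= Num.sqrt n%:R.
Proof.
move=> m0 Bm; have BU := dominant_unitmx _ _ m0 Bm.
rewrite mulrC -ler_pdivlMr//.
apply: opnorm_le => [|x]; first by rewrite divr_ge0 ?sqrtr_ge0 ?ltW.
rewrite mulrAC ler_pdivlMr// mulrC.
apply: le_trans (l1norm_le_l2norm _).
apply: le_trans (ler_wpM2l (ltW m0) (l2norm_le_l1norm _)) _.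
by rewrite -[X in _ <= l1norm X](mulKVmx BU) l1norm_mulmx_ge_dominant.
Qed.

End ModulusAndNorms.

Theorem mainTheorem6 (R : realType) (N : nat) (hN : (1 <= N)%N)
    (A : 'M[R[i]]_N) (eps : R) (heps0 : 0 < eps) (heps1 : eps < 1) :
  let d (j : 'I_N) : R[i] := A j j in
  let r (j : 'I_N) : R := \sum_(i < N | i != j) normc (A i j) in
  cond_spectrum eps A `<=`
    \bigcup_(j in [set: 'I_N])
      cdisc (d j)
        (r j + Num.sqrt (N%:R) * (2 * eps / (1 - eps)) * opnorm A).
Proof.
move=> d r z zA.
pose gap j := normc (z - d j) - r j.
(* The smallest gap is a dominance constant valid for every column at once; [hN] supplies an index
   to start from. *)
have [j gap_min] : exists j, forall k, gap j <= gap k.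
  case: (@arg_minP _ _ _ (Ordinal hN) xpredT gap isT) => j _ min_j.
  by exists j => k; apply: min_j.
exists j => //; rewrite /cdisc /= -lerBlDl -/(gap j).
have rhs0 : 0 <= Num.sqrt N%:R * (2 * eps / (1 - eps)) * opnorm A.
  rewrite mulr_ge0 ?opnorm_ge0// mulr_ge0 ?sqrtr_ge0//.
  by rewrite divr_ge0 ?mulr_ge0 ?subr_ge0 ?ltW.
(* If the gap is not positive, [z] already lies in the disc of radius [r j], before enlargement. *)
have [gap0|gap0] := leP (gap j) 0; first exact: le_trans gap0 rhs0.
pose B := z%:M - A.
(* Off the diagonal [B] is -A, so its deleted column sums are the [r k]. *)
have dom k : gap j <= normc (B k k) - \sum_(i | i != k) normc (B i k).
  apply: le_trans (gap_min k) _; rewrite /gap !mxE eqxx mulr1n lerD2l lerN2.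
  apply: ler_sum => i /negPf ik.
  by rewrite !mxE ik mulr0n sub0r normcN.
have BU : B \in unitmx := dominant_unitmx _ _ gap0 dom.
have cond : eps^-1 <= opnorm (invmx B) * opnorm B.
  by case: zA => [/negP/(_ BU) []|cond]; exact: cond.
have invB := dominant_opnorm_invmx_le _ _ gap0 dom.
have leB := opnorm_le_of_condition _ _ _ heps0 heps1 BU cond.
exact: (gap_bound R eps _ _ _ _ _ heps0 (ltW gap0) (opnorm_ge0 B)
  (sqrtr_ge0 _) cond invB leB).
Qed.
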